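(* Let $R$ be an integral domain and let $f,g\in R[X]$ be monic polynomials of degree $n\ge1$ with companion matrices $C,D\in M_n(R)$. View $M_n(R)$ as an $R[X]$-module via $C$, i.e. $p(X)\cdot A=p(C)A$ for $p\in R[X]$, $A\in M_n(R)$. If the resultant $R(f,g)$ of $f$ and $g$ is a unit in $R$, then the $R[X]$-module $M_n(R)$ has the cyclic decomposition $$M_n(R)=R[X]\cdot I\oplus R[X]\cdot D\oplus\cdots\oplus R[X]\cdot D^{n-1},$$ where the annihilating ideals are $R[X]f,R[X]f,\dots,R[X]f$, with $n$ repetitions; i.e. the invariant factors of $M_n(R)$ are $f,f,\dots,f$, with $n$ repetitions.
   Context: For monic $f=f_0+f_1X+\cdots+f_{n-1}X^{n-1}+X^n\in R[X]$ the companion matrix $C_f\in M_n(R)$ has $1$'s on the first subdiagonal, last column $(-f_0,\dots,-f_{n-1})^T$, and $0$'s elsewhere. $I$ is the identity matrix. *)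

(* Defs.v *)
From HB Require Import structures.
From mathcomp Require Import all_boot all_order all_algebra.

Set Implicit Arguments.
Unset Strict Implicit.
Unset Printing Implicit Defensive.

Import GRing.Theory.
Local Open Scope ring_scope.

(* Ones on the subdiagonal, minus the coefficients of f in the last column.
   MathComp's [companionmx] is the transpose of this matrix, with a dimension
   depending on f (see [companionE]). *)
Definition companion (R : nzRingType) (n : nat) (f : {poly R}) : 'M[R]_n.+1 :=
  \matrix_(i < n.+1, j < n.+1)
    if j == n :> nat then - f`_i else (i == j.+1 :> nat)%:R.

Lemma companionE (R : nzRingType) (n : nat) (f : {poly R})
    (sz_f : (size f).-1 = n.+1) :
  companion n f = castmx (sz_f, sz_f) (companionmx f)^T.
Proof.
apply/matrixP => i j; rewrite castmxE !mxE /= sz_f /=.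
by case: eqP => // _; rewrite eq_sym.
Qed.

Section ModuleNotions.

Variables (A : comUnitRingType) (V : lmodType A).

Definition cyclic_submodule (x v : V) : Prop := exists a : A, v = a *: x.

Definition annihilator (x : V) (a : A) : Prop := a *: x = 0.

Definition principal_ideal (d a : A) : Prop := exists b : A, a = b * d.

(* V is the internal direct sum of the submodules N 0, ..., N (k - 1). *)
Definition direct_sum (k : nat) (N : 'I_k -> V -> Prop) : Prop :=
  forall v : V, exists! x : {ffun 'I_k -> V},
    (forall i, N i (x i)) /\ v = \sum_(i < k) x i.

Definition cyclic_decomposition (k : nat) (x : 'I_k -> V) (d : 'I_k -> A) :=
  direct_sum (fun i => cyclic_submodule (x i)) /\
  (forall (i : 'I_k) (a : A),
     annihilator (x i) a <-> principal_ideal (d i) a).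

(* d 0 | d 1 | ... | d (k - 1), where divisibility is stated in the ring A
   itself: over a domain R, the relation [%|] on {poly R} is that of
   pseudo-division, i.e. divisibility over the fraction field. *)
Definition invariant_factors (k : nat) (d : 'I_k -> A) : Prop :=
  [/\ forall i, d i \isn't a GRing.unit,
      forall i j : 'I_k, (i <= j)%N -> principal_ideal (d i) (d j)
    & exists x : 'I_k -> V, cyclic_decomposition x d].

End ModuleNotions.

(* The additive group 'M[R]_n.+1, as the {poly R}-module on which p acts by
   left multiplication by p(C). *)
Definition matrix_module (R : comNzRingType) (n : nat) (C : 'M[R]_n.+1) : Type :=
  'M[R]_n.+1.

Section MatrixModule.

Variables (R : comNzRingType) (n : nat) (C : 'M[R]_n.+1).

HB.instance Definition _ := GRing.Zmodule.on (matrix_module C).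

Definition mxact (p : {poly R}) (M : matrix_module C) : matrix_module C :=
  horner_mx C p *m M.

Fact mxactA p q M : mxact p (mxact q M) = mxact (p * q) M.
Proof. by rewrite /mxact rmorphM mulmxA. Qed.

Fact mxact1 : left_id 1 mxact.
Proof. by move=> M; rewrite /mxact rmorph1 mul1mx. Qed.

Fact mxactDr : right_distributive mxact +%R.
Proof. by move=> p M N; rewrite /mxact mulmxDr. Qed.

Fact mxactDl M : {morph mxact^~ M : p q / p + q}.
Proof. by move=> p q; rewrite /mxact rmorphD mulmxDl. Qed.

HB.instance Definition _ := GRing.Zmodule_isLmodule.Build {poly R}
  (matrix_module C) mxactA mxact1 mxactDr mxactDl.

Lemma matrix_moduleZ (p : {poly R}) (M : matrix_module C) :
  p *: M = horner_mx C p *m M.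
Proof. by []. Qed.

End MatrixModule.

Arguments invariant_factors {A} V {k} d.

(* Main.v *)
Require Import Defs.
From HB Require Import structures.
From mathcomp Require Import all_boot all_order all_algebra.

Set Implicit Arguments.
Unset Strict Implicit.
Unset Printing Implicit Defensive.

Import GRing.Theory.
Local Open Scope ring_scope.

(** Write N for the size of the matrices and e_0, ..., e_(N-1) for the
standard basis of columns. The assertion amounts to this: the N ^ 2 products
C ^+ i * D ^+ j with i, j < N form an R-basis of the N x N matrices. Since
f(C) = 0, every summand p *: D ^+ j has p determined modulo f, hence p may be
taken of degree less than N.

The products generate. The matrices C and D differ only in their last column,
which makes C - D the product of the column of coefficients of g - f and of
the row e_(N-1)^T; since C^i e_0 = e_i and f(C) = 0, that column is g(C) e_0
([companion_sub]). The resultant belongs to the ideal generated by f and g, so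
that, being a unit, it yields u with u(C) g(C) = 1. On the other side, the
shape of the rows of D gives, for each j, a polynomial q with
e_(N-1)^T q(D) = e_j^T ([last_row_generates]). Hence
C^i u(C) (C - D) q(D) = e_i e_j^T, and every matrix is a linear combination of
matrices p(C) q(D), where both p and q can be reduced to degree less than N
([horner2_mx_surj]).

The products are independent, because a surjective endomorphism of a free
module of finite rank over a commutative ring is injective
([linear_mx_surj_inj]). Independence gives both the uniqueness of the
decomposition and the annihilators: p *: D ^+ j = 0 forces p modulo f to
vanish. *)

(** * Linear maps between matrices, polynomials in a matrix *)

Lemma linear_mx_surj_inj (R : comNzRingType) (m n : nat)
    (F : {linear 'M[R]_(m, n) -> 'M[R]_(m, n)}) :
  (forall M, exists A, F A = M) -> injective F.
Proof.
move=> surjF; pose P k (A : 'M[R]_(m, n)) := F A = vec_mx 'e_k.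
have /fin_all_exists[A FA] : forall k, exists A, P k A.
  by move=> k; apply: surjF.
(* Over a commutative ring, a left inverse of a square matrix is two-sided. *)
pose B := \matrix_k mxvec (A k).
have BF1 : B *m lin_mx F = 1%:M.
  apply/row_matrixP => k.
  by rewrite row_mul rowK mul_vec_lin FA vec_mxK rowE mulmx1.
move=> X Y FXY; apply: (can_inj mxvecK).
rewrite -[mxvec X]mulmx1 -[mxvec Y]mulmx1 -(mulmx1C BF1) !mulmxA.
by rewrite !mul_vec_lin FXY.
Qed.

Lemma horner_mx_coefs (R : comNzRingType) (n d : nat) (A : 'M[R]_n.+1)
    (p : {poly R}) :
  (size p <= d)%N -> horner_mx A p = \sum_(i < d) p`_i *: A ^+ i.
Proof.
move=> le_p_d; rewrite -{1}(take_poly_id le_p_d) /take_poly poly_def.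
rewrite linear_sum; apply: eq_bigr => i _.
by rewrite linearZ /= rmorphXn /= horner_mx_X.
Qed.

Lemma horner_mx_rmodp (R : comNzRingType) (n : nat) (A : 'M[R]_n.+1)
    (f p : {poly R}) :
  f \is monic -> horner_mx A f = 0 ->
  horner_mx A (Pdiv.Ring.rmodp p f) = horner_mx A p.
Proof.
move=> f_monic fA0; rewrite [in RHS](Pdiv.RingMonic.rdivp_eq f_monic p).
by rewrite rmorphD rmorphM /= fA0 mulr0 add0r.
Qed.

(** The sum of the C ^+ i *m D ^+ j weighted by the entries A j i: row j of A
lists the coefficients of the polynomial in C that multiplies D ^+ j. *)
Definition horner2_mx (R : comNzRingType) (n : nat) (C D A : 'M[R]_n.+1) :
    'M[R]_n.+1 :=
  \sum_(j < n.+1) horner_mx C (rVpoly (row j A)) *m D ^+ j.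

Fact horner2_mx_is_linear (R : comNzRingType) (n : nat) (C D : 'M[R]_n.+1) :
  linear (horner2_mx C D).
Proof.
move=> a A B; rewrite /horner2_mx scaler_sumr -big_split /=.
by apply: eq_bigr => j _; rewrite !linearP /= mulmxDl -scalemxAl.
Qed.

HB.instance Definition _ (R : comNzRingType) (n : nat) (C D : 'M[R]_n.+1) :=
  GRing.isLinear.Build R 'M[R]_n.+1 'M[R]_n.+1 *:%R (horner2_mx C D)
    (horner2_mx_is_linear C D).

Lemma horner2_mx_rows (R : comNzRingType) (n : nat) (C D : 'M[R]_n.+1)
    (r : 'I_n.+1 -> {poly R}) :
  (forall j, size (r j) <= n.+1)%N ->
  horner2_mx C D (\matrix_j poly_rV (r j))
    = \sum_(j < n.+1) horner_mx C (r j) *m D ^+ j.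
Proof.
by move=> le_r; apply: eq_bigr => j _; rewrite rowK poly_rV_K.
Qed.

(** * Companion matrices *)

Section Companion.

Variables (R : comNzRingType) (n : nat) (f : {poly R}).

Local Notation C := (companion n f).
Local Notation e0 := (delta_mx 0 0 : 'cV[R]_n.+1).

Lemma companion_exp_e0 (i : 'I_n.+1) : C ^+ i *m e0 = delta_mx i 0.
Proof.
case: i => i; elim: i => [|i IHi] lt_i /=.
  by rewrite expr0 mul1mx; congr delta_mx; apply: val_inj.
rewrite exprS -mulmxA (IHi (ltnW lt_i)) -colE.
apply/matrixP => k l; rewrite !mxE ord1 eqxx andbT /=.
have -> : (i == n) = false by rewrite ltn_eqF.
by congr (nat_of_bool _)%:R; rewrite -val_eqE.
Qed.

Lemma horner_companion_e0 (p : {poly R}) :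
  (size p <= n.+1)%N -> horner_mx C p *m e0 = \col_i p`_i.
Proof.
move=> le_p; rewrite (horner_mx_coefs _ le_p) mulmx_suml.
apply/matrixP => k l; rewrite summxE (bigD1 k) //= big1 => [|i ne_ik].
  by rewrite -scalemxAl companion_exp_e0 !mxE eqxx ord1 eqxx mulr1 addr0.
by rewrite -scalemxAl companion_exp_e0 !mxE eq_sym (negPf ne_ik) mulr0.
Qed.

Hypotheses (f_monic : f \is monic) (size_f : size f = n.+2).

Lemma horner_companion_self : horner_mx C f = 0.
Proof.
have f_split : f = 'X^(n.+1) + take_poly n.+1 f.
  apply/polyP => i; rewrite coefD coefXn coef_take_poly.
  have [lt_in | lt_ni | ->] := ltngtP i n.+1.
  - by rewrite add0r.
  - by rewrite addr0 nth_default // size_f.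
  - by rewrite addr0; have/monicP := f_monic; rewrite lead_coefE size_f.
have fC_e0 : horner_mx C f *m e0 = 0.
  rewrite [X in horner_mx _ X]f_split rmorphD rmorphXn /= horner_mx_X mulmxDl.
  rewrite horner_companion_e0 ?size_take_poly // exprS -mulmxA.
  rewrite (companion_exp_e0 ord_max) -colE.
  by apply/matrixP => k l; rewrite !mxE eqxx coef_take_poly ltn_ord addNr.
(* f(C) commutes with C, so it also kills C^i e_0, which is e_i. *)
have fC_e l : horner_mx C f *m (delta_mx l 0 : 'cV_n.+1) = 0.
  have -> : delta_mx l 0 = horner_mx C 'X^l *m e0 :> 'cV_n.+1.
    by rewrite rmorphXn /= horner_mx_X companion_exp_e0.
  rewrite mulmxA (comm_horner_mx2 C f 'X^l : _ *m _ = _ *m _).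
  by rewrite -mulmxA fC_e0 mulmx0.
apply/matrixP => k l.
by have /matrixP/(_ k 0) := fC_e l; rewrite -colE !mxE.
Qed.

(** For j < n, row j.+1 of C is e_j^T - f_(j+1) e_n^T, so that the row vectors
e_j^T are obtained from e_n^T in decreasing order of j, in the manner of
Horner. *)
Lemma last_row_generates (j : 'I_n.+1) :
  exists q : {poly R}, 'e_ord_max *m horner_mx C q = 'e_j :> 'rV_n.+1.
Proof.
have [k le_k] : exists k, (n - j <= k)%N by exists (n - j)%N.
elim: k => [|k IHk] in j le_k *.
  have -> : j = ord_max.
    apply: val_inj; apply/eqP; rewrite eqn_leq -ltnS ltn_ord /=.
    by rewrite -subn_eq0 -leqn0.
  by exists 1; rewrite rmorph1 mulmx1.
have [j_n | ne_jn] := eqVneq (j : nat) n.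
  by apply: IHk; rewrite j_n subnn.
have lt_jn : (j.+1 < n.+1)%N by rewrite ltnS ltn_neqAle ne_jn -ltnS ltn_ord.
have [|q def_q] := IHk (Ordinal lt_jn).
  by rewrite /= subnS; case: (n - j)%N le_k.
exists (q * 'X + (f`_j.+1)%:P).
rewrite rmorphD rmorphM /= horner_mx_X horner_mx_C mulmxDr mulmxA def_q.
rewrite mul_mx_scalar -rowE; apply/rowP => l; rewrite !mxE /= eqSS.
rewrite -!val_eqE /=.
have [-> | ne_ln] := eqVneq (l : nat) n.
  by rewrite mulr1 addNr eq_sym (negPf ne_jn).
by rewrite mulr0 addr0 eq_sym.
Qed.

End Companion.

(** Both sides vanish outside the last column, where they contain the
coefficients of g - f, a polynomial of degree at most n congruent to g
modulo f. *)
Lemma companion_sub (R : comNzRingType) (n : nat) (f g : {poly R}) :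
  f \is monic -> size f = n.+2 -> g \is monic -> size g = n.+2 ->
  companion n f - companion n g
    = horner_mx (companion n f) g *m delta_mx 0 ord_max.
Proof.
move=> f_monic size_f g_monic size_g.
have size_gf : (size (g - f)%R <= n.+1)%N.
  apply/leq_sizeP => i; rewrite leq_eqVlt coefB => /predU1P[<- | lt_ni].
    have /monicP := f_monic; have /monicP := g_monic.
    by rewrite !lead_coefE size_f size_g /= => -> ->; rewrite subrr.
  by rewrite !nth_default ?size_f ?size_g ?subrr.
have -> : horner_mx (companion n f) g = horner_mx (companion n f) (g - f).
  by rewrite rmorphB /= horner_companion_self ?subr0.
rewrite -(mul_delta_mx (0 : 'I_1)) mulmxA horner_companion_e0 //.
apply/matrixP => i j; rewrite !mxE big_ord1 !mxE /= -val_eqE /= coefB.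
have [_ | _] := eqVneq (j : nat) n; first by rewrite mulr1 opprK addrC.
by rewrite subrr mulr0.
Qed.

(** * Generation by the products of powers *)

Lemma horner2_mx_mul_horner (R : comNzRingType) (n : nat) (f g p q : {poly R})
    (C := companion n f) (D := companion n g) :
  f \is monic -> size f = n.+2 -> g \is monic -> size g = n.+2 ->
  exists A, horner2_mx C D A = horner_mx C p *m horner_mx D q.
Proof.
move=> f_monic size_f g_monic size_g.
have size_mod (h r : {poly R}) : h \is monic -> size h = n.+2 ->
    (size (Pdiv.Ring.rmodp r h) <= n.+1)%N.
  move=> h_monic size_h.
  by rewrite -ltnS -size_h Pdiv.Ring.ltn_rmodpN0 ?monic_neq0.
pose s := Pdiv.Ring.rmodp q g.
pose r (j : 'I_n.+1) := s`_j *: Pdiv.Ring.rmodp p f.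
exists (\matrix_j poly_rV (r j)); rewrite horner2_mx_rows => [|j]; last first.
  exact: leq_trans (size_scale_leq _ _) (size_mod _ _ f_monic size_f).
rewrite -(horner_mx_rmodp q g_monic) ?horner_companion_self //.
rewrite (horner_mx_coefs _ (size_mod _ _ g_monic size_g)) mulmx_sumr.
apply: eq_bigr => j _; rewrite linearZ /= horner_mx_rmodp //; last first.
  exact: horner_companion_self.
by rewrite -scalemxAl -scalemxAr.
Qed.

Lemma horner2_mx_surj (R : idomainType) (n : nat) (f g : {poly R})
    (C := companion n f) (D := companion n g) :
  f \is monic -> size f = n.+2 -> g \is monic -> size g = n.+2 ->
  resultant f g \is a GRing.unit ->
  forall M, exists A, horner2_mx C D A = M.
Proof.
move=> f_monic size_f g_monic size_g res_unit.
have fC0 : horner_mx C f = 0 by apply: horner_companion_self.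
have [|| [v u] _ /= def_res] := @resultant_in_ideal _ f g.
- by rewrite size_f.
- by rewrite size_g.
pose c := (resultant f g)^-1.
have ugC1 : horner_mx C (c *: u) *m horner_mx C g = 1%:M.
  rewrite linearZ -scalemxAl /=.
  have <- : horner_mx C (u * g) = horner_mx C u *m horner_mx C g.
    by rewrite rmorphM.
  have -> : u * g = (resultant f g)%:P - v * f by rewrite def_res addrC addKr.
  rewrite rmorphB rmorphM /= fC0 mulr0 subr0 horner_mx_C.
  by rewrite scale_scalar_mx mulVr.
pose P (ij : 'I_n.+1 * 'I_n.+1) A := horner2_mx C D A = delta_mx ij.1 ij.2.
have /fin_all_exists[A defA] : forall ij, exists A, P ij A.
  case=> i j; rewrite /P /=.
  have [q def_q] := last_row_generates g j.
  pose p := 'X^i * (c *: u).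
  have gen := horner2_mx_mul_horner _ _ f_monic size_f g_monic size_g.
  have [A1 defA1] := gen (p * 'X) q; have [A2 defA2] := gen p ('X * q).
  (* e_i e_j^T = p(C) (C - D) q(D), where p(C) g(C) = C^i. *)
  exists (A1 - A2); rewrite linearB /= defA1 defA2 !rmorphM /= !horner_mx_X.
  rewrite -!mulmxE -!mulmxA -!mulmxBr !mulmxA -mulmxBl.
  rewrite companion_sub // !mulmxA -(mulmxA _ _ (horner_mx C g)) ugC1 mulmx1.
  rewrite rmorphXn /= horner_mx_X.
  rewrite -(mul_delta_mx (0 : 'I_1)) mulmxA companion_exp_e0 -mulmxA def_q.
  by rewrite mul_delta_mx.
move=> M; exists (\sum_i \sum_j M i j *: A (i, j)).
rewrite linear_sum [RHS]matrix_sum_delta; apply: eq_bigr => i _.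
rewrite linear_sum; apply: eq_bigr => j _.
by rewrite linearZ /= defA.
Qed.

(** * The cyclic decomposition *)

Theorem theorem9p2 (R : idomainType) (n : nat) (f g : {poly R})
    (f_monic : f \is monic) (size_f : size f = n.+2)
    (g_monic : g \is monic) (size_g : size g = n.+2)
    (res_unit : resultant f g \is a GRing.unit) :
  let C := companion n f in
  let D := companion n g in
  @cyclic_decomposition {poly R} (matrix_module C) n.+1
    (fun i => D ^+ i) (fun=> f)
  /\ invariant_factors (matrix_module C) (fun _ : 'I_n.+1 => f).
Proof.
move=> C D.
have fC0 : horner_mx C f = 0 by apply: horner_companion_self.
have surj := horner2_mx_surj f_monic size_f g_monic size_g res_unit.
have inj : injective (horner2_mx C D) by apply: linear_mx_surj_inj.
have size_mod p : (size (Pdiv.Ring.rmodp p f) <= n.+1)%N.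
  by rewrite -ltnS -size_f Pdiv.Ring.ltn_rmodpN0 ?monic_neq0.
(* Coefficients of degree at most n are determined by the sum. *)
have uniq_coef (r s : 'I_n.+1 -> {poly R}) :
    (forall j, size (r j) <= n.+1)%N -> (forall j, size (s j) <= n.+1)%N ->
    \sum_j horner_mx C (r j) *m D ^+ j = \sum_j horner_mx C (s j) *m D ^+ j ->
  r =1 s.
  move=> le_r le_s eq_rs j; rewrite -!horner2_mx_rows // in eq_rs.
  have /row_matrixP/(_ j) := inj _ _ eq_rs; rewrite !rowK => /(congr1 rVpoly).
  by rewrite !poly_rV_K.
have dec : @cyclic_decomposition {poly R} (matrix_module C) n.+1
    (fun i => D ^+ i) (fun=> f).
  split=> [M | i a].
    have [A defA] := surj M.
    exists [ffun j : 'I_n.+1 => horner_mx C (rVpoly (row j A)) *m D ^+ j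
                                : matrix_module C].
    split; first split=> [j|].
    - by rewrite ffunE; exists (rVpoly (row j A)).
    - by rewrite -defA; apply: eq_bigr => j _; rewrite ffunE.
    move=> x [/fin_all_exists[a def_x] def_M].
    have xE j : x j = horner_mx C (Pdiv.Ring.rmodp (a j) f) *m D ^+ j.
      by rewrite def_x horner_mx_rmodp.
    apply/ffunP => j; rewrite ffunE xE; congr (horner_mx C _ *m _).
    apply: (uniq_coef (fun j => rVpoly (row j A))
                      (fun j => Pdiv.Ring.rmodp (a j) f)) => // [k|].
      exact: size_poly.
    rewrite [LHS]defA def_M; exact: eq_bigr.
  split=> [aD0 | [b ->]]; last first.
    rewrite /annihilator matrix_moduleZ rmorphM /= fC0 mulr0.
    exact: mul0mx.
  pose r := Pdiv.Ring.rmodp a f.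
  suff r0 : r = 0.
    exists (Pdiv.Ring.rdivp a f).
    by rewrite {1}(Pdiv.RingMonic.rdivp_eq f_monic a) -/r r0 addr0.
  have := uniq_coef (fun j => if j == i then r else 0) (fun=> 0).
  move=> /(_ _ _ _ i); rewrite eqxx; apply=> [j|j|].
  - by case: eqP => _; rewrite ?size_mod ?size_poly0.
  - by rewrite size_poly0.
  rewrite (bigD1 i) //= eqxx horner_mx_rmodp // [X in X + _]aD0 add0r.
  rewrite !big1 // => [j _ | j /negPf->]; rewrite rmorph0; exact: mul0mx.
split=> //; split=> [i | i j _ |]; last by exists (fun i => D ^+ i).
  by rewrite poly_unitE size_f.
by exists 1; rewrite mul1r.
Qed.
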